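(* Let $(C_n)_{n\ge 1}$ be any (uniform or non-uniform) family of depth-$2$ Boolean circuits (DNFs, i.e. ORs of ANDs of literals, or CNFs, i.e. ANDs of ORs of literals) such that $C_n$ decides Group Isomorphism on pairs of multiplication tables of order $n$. Then the family has size $n^{\Omega(\log n)}$; that is, there is an absolute constant $c>0$, independent of the family, such that for infinitely many $n$ the circuit $C_n$ has size at least $n^{c\log n}$.
   Context: Multiplication (Cayley) table model: a binary operation on the set $[n]$ is given by its $n\times n$ table, each entry encoded by $\lceil\log_2 n\rceil$ bits. Group Isomorphism (as a total language): the input is a pair $(T_1,T_2)$ of $n\times n$ tables; it is a yes-instance if and only if both $T_1$ and $T_2$ are multiplication tables of groups (of order $n$) and these two groups are isomorphic. The size of a circuit is its number of gates; AND and OR gates have unbounded fan-in, and the inputs of the bottom-level gates are literals (input variables or their negations). *)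

(* Defs.v *)
From mathcomp Require Import all_boot all_order all_algebra.
From mathcomp Require Import reals exp.

Set Implicit Arguments.
Unset Strict Implicit.
Unset Printing Implicit Defensive.

(* A table is an arbitrary binary operation on [n] = {0, ..., n-1}; no
   algebraic law is assumed. *)
Definition table (n : nat) : Type := 'I_n -> 'I_n -> 'I_n.

Definition is_group_table (n : nat) (T : table n) : Prop :=
  associative T /\
  exists e : 'I_n,
    [/\ left_id e T, right_id e T
      & forall x : 'I_n, exists y : 'I_n, T x y = e /\ T y x = e].

Definition isomorphic_tables (n : nat) (T1 T2 : table n) : Prop :=
  exists f : 'I_n -> 'I_n,
    bijective f /\ {morph f : x y / T1 x y >-> T2 x y}.

Definition group_iso_instance (n : nat) (T1 T2 : table n) : Prop :=
  [/\ is_group_table T1, is_group_table T2 & isomorphic_tables T1 T2].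

(* The variable (b, i, j, k) is the bit of weight 2 ^ k of the (i, j) entry of
   the first (b = false) or second (b = true) table; up_log 2 n is the ceiling
   of the base-2 logarithm of n. *)
Definition input_var (n : nat) : finType :=
  (bool * 'I_n * 'I_n * 'I_(up_log 2 n))%type.

Definition encode (n : nat) (T1 T2 : table n) (v : input_var n) : bool :=
  let: (b, i, j, k) := v in
  odd ((if b then T2 i j else T1 i j) %/ 2 ^ k).

(* (v, true) is the variable v and (v, false) is its negation. *)
Definition literal (n : nat) : Type := (input_var n * bool)%type.

Definition eval_literal (n : nat) (w : input_var n -> bool) (l : literal n) :
  bool := w l.1 == l.2.

(* Each element of the outer list is one bottom gate, given by the list of its
   inputs. *)
Inductive depth2_circuit (n : nat) : Type :=
| DNF of seq (seq (literal n))
| CNF of seq (seq (literal n)).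

Definition eval_circuit (n : nat) (C : depth2_circuit n)
    (w : input_var n -> bool) : bool :=
  match C with
  | DNF gs => has (all (eval_literal w)) gs
  | CNF gs => all (has (eval_literal w)) gs
  end.

(* The output gate is counted, whence the successor. *)
Definition circuit_size (n : nat) (C : depth2_circuit n) : nat :=
  match C with DNF gs | CNF gs => (size gs).+1 end.

(* When n is not a power of 2, nothing is required on the bit strings that
   encode an entry outside [n]; a circuit that also rejects those strings
   decides the language a fortiori. *)
Definition decides_group_iso (n : nat) (C : depth2_circuit n) : Prop :=
  forall T1 T2 : table n,
    eval_circuit C (encode T1 T2) <-> group_iso_instance T1 T2.

(* Main.v *)
(* Take n = 2 ^ (3 m + 2). For an F_2-matrix A with a = 2 m rows and b = m + 1
   columns, the elements (u, s, z) of F_2^a x F_2 x F_2^b, labelled by the binary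
   digits of their index, form a group G_A under
     (u, s, z) (u', s', z') = (u + u', s + s', z + z' + s u' A).
   It has exactly 2 ^ rank A squares, so G_A and G_B are isomorphic iff A and B
   have equal rank; and every bit of the table of G_A depends on at most one
   column of A. For X in M_m(F_2), the block matrix A_X = [1, 1; X, X 1] (whose
   last column is the sum of the others) has rank m, but when one of the first m
   columns is replaced by the corresponding, different, column of A_X', the rank
   becomes m + 1. So the inputs attached to the 2 ^ (m ^ 2) matrices X form a
   fooling set: no bottom gate can serve two of them, as it would then also
   serve the mixed input, on which the answer differs. *)

Require Import Defs.
From mathcomp Require Import all_boot all_order all_algebra.
From mathcomp Require Import reals exp.
From mathcomp Require Import mxabelem zify.
Import Order.TTheory GRing.Theory Num.Theory.
Local Open Scope ring_scope.

Set Implicit Arguments.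
Unset Strict Implicit.
Unset Printing Implicit Defensive.

(** * Binary digits as vectors over the field with two elements *)

Section BinaryDigits.

Lemma odd_div_inj (d i j : nat) : (i < 2 ^ d)%N -> (j < 2 ^ d)%N ->
  (forall k, (k < d)%N -> odd (i %/ 2 ^ k) = odd (j %/ 2 ^ k)) -> i = j.
Proof.
elim: d i j => [|d IHd] i j; first by rewrite expn0 !ltnS !leqn0 => /eqP-> /eqP->.
rewrite expnS => lti ltj eq_ij.
have half_lt n : (n < 2 * 2 ^ d)%N -> (n./2 < 2 ^ d)%N.
  by move=> ltn; rewrite -divn2 ltn_divLR // mulnC.
have eqh : i./2 = j./2.
  apply: IHd; [exact: half_lt | exact: half_lt |] => k ltkd.
  by rewrite -!divn2 -!divnMA -expnS eq_ij.
have := eq_ij 0%N isT; rewrite !divn1 => eqo.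
by rewrite -(odd_double_half i) -(odd_double_half j) eqh eqo.
Qed.

Lemma pchar_F2 : 2%N \in [pchar 'F_2].
Proof. exact: pchar_Fp. Qed.

Lemma odd_F2 (k : nat) : odd k = (k%:R != 0 :> 'F_2).
Proof. by rewrite -(dvdn_pcharf pchar_F2) dvdn2 negbK. Qed.

(** The cast to ['F_2] keeps only the parity of the quotient, so coordinate [k] is the bit of weight
    [2 ^ k]. *)
Definition digits (d : nat) (i : 'I_(2 ^ d)) : 'rV['F_2]_d :=
  \row_k (i %/ 2 ^ k)%:R.

Lemma digits_bij (d : nat) : bijective (@digits d).
Proof.
apply: inj_card_bij => [i j eq_ij|].
  apply: val_inj; apply: (@odd_div_inj d); rewrite ?ltn_ord // => k ltkd.
  by have /rowP/(_ (Ordinal ltkd)) := eq_ij; rewrite !mxE !odd_F2 => ->.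
by rewrite card_ord card_mx card_Fp // mul1n.
Qed.

Lemma odd_digits (d : nat) (i : 'I_(2 ^ d)) (k : 'I_d) :
  odd (i %/ 2 ^ k) = (digits i 0 k != 0).
Proof. by rewrite mxE -odd_F2. Qed.

End BinaryDigits.

(** * The groups attached to matrices in characteristic 2 *)

Section TwistedSum.

Variables (F : finFieldType) (a b : nat).
Hypothesis pcharF2 : 2%N \in [pchar F].
Local Notation elt := 'rV[F]_(a + (1 + b)).

Definition head_part (x : elt) : 'rV[F]_a := lsubmx x.
Definition switch (x : elt) : F := lsubmx (rsubmx x) 0 0.
Definition tail_part (x : elt) : 'rV[F]_b := rsubmx (rsubmx x).
Definition in_tail (z : 'rV[F]_b) : elt := row_mx 0 (row_mx 0 z).

(** The central extension given by the cocycle s u' A, whose bilinearity yields associativity. *)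
Definition twisted_sum (A : 'M[F]_(a, b)) (x y : elt) : elt :=
  x + y + in_tail (switch x *: (head_part y *m A)).

Lemma head_partD x y : head_part (x + y) = head_part x + head_part y.
Proof. by apply/rowP=> k; rewrite !mxE. Qed.

Lemma switchD x y : switch (x + y) = switch x + switch y.
Proof. by rewrite /switch !mxE. Qed.

Lemma tail_partD x y : tail_part (x + y) = tail_part x + tail_part y.
Proof. by apply/rowP=> k; rewrite !mxE. Qed.

Lemma head_part_tail z : head_part (in_tail z) = 0.
Proof. by rewrite /head_part row_mxKl. Qed.

Lemma switch_tail z : switch (in_tail z) = 0.
Proof. by rewrite /switch row_mxKr row_mxKl mxE. Qed.

Lemma tail_part_tail z : tail_part (in_tail z) = z.
Proof. by rewrite /tail_part !row_mxKr. Qed.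

Lemma in_tail0 : in_tail 0 = 0.
Proof. by rewrite /in_tail !row_mx0. Qed.

Lemma in_tail_inj : injective in_tail.
Proof. by move=> z t /(congr1 tail_part); rewrite !tail_part_tail. Qed.

Lemma elt_eq (x y : elt) : head_part x = head_part y ->
  switch x = switch y -> tail_part x = tail_part y -> x = y.
Proof.
move=> eqh eqs eqt; rewrite -(hsubmxK x) -(hsubmxK y) -(hsubmxK (rsubmx x)).
rewrite -(hsubmxK (rsubmx y)); congr (row_mx _ (row_mx _ _)) => //.
by apply/rowP=> k; rewrite ord1.
Qed.

Lemma head_partE A x y :
  head_part (twisted_sum A x y) = head_part x + head_part y.
Proof. by rewrite !head_partD head_part_tail addr0. Qed.

Lemma switchE A x y : switch (twisted_sum A x y) = switch x + switch y.
Proof. by rewrite !switchD switch_tail addr0. Qed.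

Lemma tail_partE A x y : tail_part (twisted_sum A x y) =
  tail_part x + tail_part y + switch x *: (head_part y *m A).
Proof. by rewrite !tail_partD tail_part_tail. Qed.

Lemma twisted_sumA A : associative (twisted_sum A).
Proof.
move=> x y z; apply: elt_eq.
- by rewrite !head_partE addrA.
- by rewrite !switchE addrA.
rewrite !tail_partE head_partE switchE mulmxDl scalerDr scalerDl !addrA.
by rewrite [LHS](ACl (1 * 2 * 5 * 3 * 6 * 4)%AC).
Qed.

Lemma twisted_sum0x A : left_id 0 (twisted_sum A).
Proof.
by move=> x; rewrite /twisted_sum /switch !mxE scale0r in_tail0 add0r addr0.
Qed.

Lemma twisted_sumx0 A : right_id 0 (twisted_sum A).
Proof.
move=> x; have -> : twisted_sum A x 0 = x + 0 + in_tail 0.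
  by congr (_ + in_tail _); rewrite /head_part linear0 mul0mx scaler0.
by rewrite in_tail0 !addr0.
Qed.

Lemma oppr_elt (x : elt) : - x = x.
Proof. by apply/rowP=> k; rewrite mxE oppr_pchar2. Qed.

Lemma twisted_sum_inv A x :
  exists y, twisted_sum A x y = 0 /\ twisted_sum A y x = 0.
Proof.
(* The square of [x] is [in_tail t], so correcting [x] by this central element gives its inverse. *)
pose t := switch x *: (head_part x *m A).
have addxx (y : elt) : y + y = 0 by rewrite -{2}[y]oppr_elt subrr.
exists (x + in_tail t); rewrite /twisted_sum head_partD switchD.
rewrite head_part_tail switch_tail !addr0 -/t.
by split; last rewrite -addrA addxx; rewrite // addrA addxx add0r addxx.
Qed.

Definition squares (A : 'M[F]_(a, b)) : {set elt} :=
  [set twisted_sum A x x | x : elt].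

(** As [x + x = 0], only the cocycle survives in a square; with switch 1 it already fills the row
    space of [A]. *)
Lemma squaresE A : squares A = in_tail @: rowg A.
Proof.
have sq x : twisted_sum A x x = in_tail (switch x *: (head_part x *m A)).
  by rewrite /twisted_sum -{2}[x]oppr_elt subrr add0r.
apply/setP=> y; apply/imsetP/imsetP => [[x _ ->]|[z]].
  exists (switch x *: (head_part x *m A)); last exact: sq.
  by rewrite mem_rowg scalemx_sub // submxMl.
rewrite mem_rowg => /submxP[u ->] ->.
exists (row_mx u (row_mx 1 0)) => //.
by rewrite sq /switch /head_part row_mxKr !row_mxKl mxE scale1r.
Qed.

Lemma card_squares A : #|squares A| = (#|F| ^ \rank A)%N.
Proof.
by rewrite squaresE (card_imset _ in_tail_inj) card_rowg.
Qed.

(** Gaussian elimination gives invertible [P], [Q] with [P *m B = A *m Q], and (u, s, z) -> (u P, s,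
    z Q) then carries one cocycle to the other. *)
Lemma twisted_sum_iso A B : \rank A = \rank B ->
  exists f : elt -> elt,
    bijective f /\ {morph f : x y / twisted_sum A x y >-> twisted_sum B x y}.
Proof.
move=> eqr.
pose P := col_ebase A *m invmx (col_ebase B).
pose Q := invmx (row_ebase A) *m row_ebase B.
have PB_AQ : P *m B = A *m Q.
  rewrite -{1}(mulmx_ebase A) -{1}(mulmx_ebase B) /P /Q eqr !mulmxA.
  by rewrite mulmxKV ?col_ebase_unit // mulmxK ?row_ebase_unit.
have unitP : P \in unitmx by rewrite unitmx_mul unitmx_inv !col_ebase_unit.
have unitQ : Q \in unitmx by rewrite unitmx_mul unitmx_inv !row_ebase_unit.
pose f U V (x : elt) : elt :=
  row_mx (head_part x *m U) (row_mx (lsubmx (rsubmx x)) (tail_part x *m V)).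
have headf U V x : head_part (f U V x) = head_part x *m U.
  by rewrite /head_part row_mxKl.
have switchf U V x : switch (f U V x) = switch x.
  by rewrite /switch row_mxKr row_mxKl.
have tailf U V x : tail_part (f U V x) = tail_part x *m V.
  by rewrite /tail_part !row_mxKr.
exists (f P Q); split.
  exists (f (invmx P) (invmx Q)) => x; apply: elt_eq;
    by rewrite ?switchf ?headf ?tailf ?mulmxK ?mulmxKV.
move=> x y; apply: elt_eq.
- by rewrite headf !head_partE !headf mulmxDl.
- by rewrite switchf !switchE !switchf.
rewrite tailf !tail_partE headf switchf !tailf !mulmxDl -scalemxAl.
by rewrite -[_ *m A *m _]mulmxA -PB_AQ (mulmxA _ P).
Qed.

(** The number of squares is invariant, and it determines the rank because [#|F| > 1]. *)
Lemma twisted_sum_iso_rank A B (f : elt -> elt) : bijective f ->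
  {morph f : x y / twisted_sum A x y >-> twisted_sum B x y} ->
  \rank A = \rank B.
Proof.
move=> bijf fM; apply: (@expnI #|F|); first exact: card_finNzRing_gt1.
rewrite -!card_squares.
rewrite -(card_imset _ (bij_inj bijf)); congr #|pred_of_set _|.
have [g fK gK] := bijf.
apply/setP=> y; apply/imsetP/imsetP => [[_ /imsetP[x _ ->] ->]|[x _ ->]].
  by exists (f x) => //; rewrite fM.
exists (twisted_sum A (g x) (g x)); first by apply/imsetP; exists (g x).
by rewrite fM gK.
Qed.

(** Tail coordinate [l] of u' A involves only column [l]; for head and switch coordinates the
    hypothesis is vacuous. *)
Lemma twisted_sum_col (A B : 'M[F]_(a, b)) x y (k : 'I_(a + (1 + b))) :
  (forall (l : 'I_b), k = rshift a (rshift 1 l) -> forall i, A i l = B i l) ->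
  twisted_sum A x y 0 k = twisted_sum B x y 0 k.
Proof.
move=> eqAB; rewrite /twisted_sum mxE [RHS]mxE; congr (_ + _).
rewrite /in_tail; case: (split_ordP k) => k' Ek; first by rewrite Ek !row_mxEl.
case: (split_ordP k') => l El; first by rewrite Ek El !row_mxEr !row_mxEl.
rewrite Ek El !row_mxEr !mxE; congr (_ * _); apply: eq_bigr => i _.
by rewrite (eqAB l) // Ek El.
Qed.

End TwistedSum.

(** * Tables of these groups as circuit inputs *)

Definition mixture (n : nat) (w w1 w2 : input_var n -> bool) : Prop :=
  forall v, w v = w1 v \/ w v = w2 v.

Section Tables.

Variables (F : finFieldType) (a b n : nat).
Hypothesis pcharF2 : 2%N \in [pchar F].
Variables (vec : 'I_n -> 'rV[F]_(a + (1 + b))).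
Variables (unvec : 'rV[F]_(a + (1 + b)) -> 'I_n).
Hypotheses (vecK : cancel vec unvec) (unvecK : cancel unvec vec).

Definition twisted_table (A : 'M[F]_(a, b)) : table n :=
  fun i j => unvec (twisted_sum A (vec i) (vec j)).

Lemma twisted_table_group A : is_group_table (twisted_table A).
Proof.
split=> [i j k|]; first by rewrite /twisted_table !unvecK twisted_sumA.
exists (unvec 0); rewrite /twisted_table; split=> [i|i|i].
- by rewrite unvecK twisted_sum0x vecK.
- by rewrite unvecK twisted_sumx0 vecK.
have [y [xy yx]] := twisted_sum_inv pcharF2 A (vec i).
by exists (unvec y); rewrite unvecK xy yx.
Qed.

Lemma twisted_table_iso A B :
  isomorphic_tables (twisted_table A) (twisted_table B) <-> \rank A = \rank B.
Proof.
have bd : bijective vec by exists unvec.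
have bu : bijective unvec by exists vec.
split=> [[f [bijf fM]]|/twisted_sum_iso[f [bijf fM]]].
  apply: (@twisted_sum_iso_rank _ _ _ pcharF2 A B (vec \o f \o unvec)).
    exact: bij_comp (bij_comp bd bijf) bu.
  move=> x y /=; have := fM (unvec x) (unvec y).
  by rewrite /twisted_table !unvecK => ->; rewrite unvecK.
exists (unvec \o f \o vec); split; first exact: bij_comp (bij_comp bu bijf) bd.
by move=> i j /=; rewrite /twisted_table !unvecK fM.
Qed.

Lemma twisted_table_instance A B :
  group_iso_instance (twisted_table A) (twisted_table B) <-> \rank A = \rank B.
Proof.
rewrite -twisted_table_iso; split=> [[]//|isoAB].
by split=> //; apply: twisted_table_group.
Qed.

Hypothesis vec_bit : forall (i : 'I_n) (k : 'I_(a + (1 + b))),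
  odd (i %/ 2 ^ k) = (vec i 0 k != 0).
Hypothesis bits_n : (up_log 2 n <= a + (1 + b))%N.

(** The first table is common, and a bit of the second sees at most one column of [B], which comes
    from [A1] or [A2]. *)
Lemma encode_mixture (D A1 A2 B : 'M[F]_(a, b)) :
  (forall l : 'I_b, (forall i, B i l = A1 i l) \/ (forall i, B i l = A2 i l)) ->
  mixture (encode (twisted_table D) (twisted_table B))
    (encode (twisted_table D) (twisted_table A1))
    (encode (twisted_table D) (twisted_table A2)).
Proof.
move=> eqBA; case=> [[[[] i] j] k] /=; last by left.
have ltk : (k < a + (1 + b))%N := leq_trans (ltn_ord k) bits_n.
rewrite -[nat_of_ord k]/(nat_of_ord (Ordinal ltk)) !vec_bit !unvecK.
set k' := Ordinal ltk.
case: (split_ordP k') => [h Ek|h Ek].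
  by left; rewrite (@twisted_sum_col _ _ _ B A1) // => l /eqP; rewrite Ek eq_lrshift.
case: (split_ordP h) => [o Eh|l Eh].
  left; rewrite (@twisted_sum_col _ _ _ B A1) // => l.
  by rewrite Ek Eh => /rshift_inj/eqP; rewrite eq_lrshift.
have tail_l l' : k' = rshift a (rshift 1 l') -> l' = l.
  by rewrite Ek Eh => /rshift_inj/rshift_inj.
by have [eqB|eqB] := eqBA l; [left; rewrite (@twisted_sum_col _ _ _ B A1) |
  right; rewrite (@twisted_sum_col _ _ _ B A2)] => // l' /tail_l ->.
Qed.

End Tables.

(** * Bottom gates on mixed inputs *)

Section Mixtures.

Variable n : nat.
Implicit Types (w : input_var n -> bool) (g : seq (literal n)).

Lemma all_mixture w w1 w2 g : mixture w w1 w2 ->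
  all (eval_literal w1) g -> all (eval_literal w2) g -> all (eval_literal w) g.
Proof.
move=> mix /allP g1 /allP g2; apply/allP=> l lg; rewrite /eval_literal.
by case: (mix l.1) => ->; [apply: g1 | apply: g2].
Qed.

Lemma has_mixture w w1 w2 g : mixture w w1 w2 ->
  has (eval_literal w) g -> has (eval_literal w1) g || has (eval_literal w2) g.
Proof.
move=> mix /hasP[l lg]; rewrite /eval_literal => wl.
by case: (mix l.1) wl => -> wl; apply/orP; [left | right]; apply/hasP; exists l.
Qed.

(** Sending [i] to the first gate satisfying [P i] is injective. *)
Lemma fooling_set_bound (I : finType) (gates : seq (seq (literal n)))
    (P : I -> pred (seq (literal n))) :
  (forall i, has (P i) gates) ->
  (forall i j g, g \in gates -> P i g -> P j g -> i = j) ->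
  (#|I| <= size gates)%N.
Proof.
move=> hasP_ P_inj.
have gate_lt i : (find (P i) gates < size gates)%N by rewrite -has_find.
rewrite -[size gates]card_ord; apply: (@leq_card _ _ (fun i => Ordinal (gate_lt i))).
move=> i j [eq_ij]; apply: (P_inj i j (nth [::] gates (find (P i) gates))).
- exact: mem_nth.
- exact: nth_find.
- by rewrite eq_ij; apply: nth_find.
Qed.

End Mixtures.

(** * Block matrices of the fooling set *)

Section FoolingFamily.

Variable m : nat.
Local Notation Mat := 'M['F_2]_m.
Local Notation ones := (const_mx 1 : 'cV['F_2]_m).

Definition augmented (X : Mat) (c : 'cV['F_2]_m) : 'M['F_2]_(m + m, m + 1) :=
  block_mx 1%:M ones X c.

Definition dependent (X : Mat) : 'M['F_2]_(m + m, m + 1) :=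
  augmented X (X *m ones).

(** The matrix factors through dimension [m], as one with a left inverse times one with a right
    inverse. *)
Lemma rank_dependent X : \rank (dependent X) = m.
Proof.
have -> : dependent X = col_mx 1%:M X *m row_mx 1%:M ones.
  by rewrite mul_col_row !mulmx1 mul1mx.
rewrite mxrankMfree; last first.
  apply/row_freeP; exists (col_mx 1%:M 0).
  by rewrite mul_row_col mulmx1 mulmx0 addr0.
apply/eqP/row_fullP; exists (row_mx 1%:M 0).
by rewrite mul_row_col mulmx1 mul0mx addr0.
Qed.

(** A relation (u, t) among the columns has u = - t 1 by the top blocks; the bottom ones then give t
    c = t X 1, so t = 0. *)
Lemma rank_augmented X c :
  c != X *m ones -> \rank (augmented X c) = (m + 1)%N.
Proof.
move=> neq; rewrite -mxrank_tr; apply/eqP/inj_row_free => w.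
rewrite -[w]hsubmxK; set u := lsubmx w; set t := rsubmx w.
rewrite /augmented tr_block_mx mul_row_block trmx1 mulmx1.
rewrite -[RHS](@row_mx0 _ 1 m m) => /eq_row_mx[/eqP].
rewrite addr_eq0 => /eqP ->; rewrite mulNmx -mulmxA -trmx_mul => /eqP.
rewrite addrC subr_eq0 [t]mx11_scalar !mul_scalar_mx.
have [-> _|t0 /eqP/(scalerI t0)/trmx_inj eqc] := eqVneq (t 0 0) 0.
  by rewrite scale0r oppr0 raddf0 row_mx0.
by rewrite eqc eqxx in neq.
Qed.

Lemma dependent_mixture X1 X2 : X1 != X2 ->
  exists2 B : 'M['F_2]_(m + m, m + 1), \rank B = (m + 1)%N &
    forall l, (forall i, B i l = dependent X1 i l) \/
              (forall i, B i l = dependent X2 i l).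
Proof.
move=> neq.
have [k [j neq_kj]] : exists k j, X1 k j != X2 k j.
  case: (pickP (fun kj => X1 kj.1 kj.2 != X2 kj.1 kj.2)) => [[k j] ?|eqX].
    by exists k, j.
  case/eqP: neq; apply/matrixP=> k j; apply/eqP.
  by have /negbFE := eqX (k, j).
pose Y : Mat := \matrix_(i, l) (if l == j then X2 i l else X1 i l).
exists (augmented Y (X1 *m ones)).
  (* In row [k] the last column is the row sum of [X1], which differs from that of [Y] by the entry
     at [j] alone. *)
  apply: rank_augmented; apply/eqP=> /matrixP/(_ k 0)/eqP.
  rewrite !mxE (bigD1 j) //= [X in _ == X](bigD1 j) //= !mxE eqxx.
  rewrite (eq_bigr (fun l => Y k l * ones l 0)) => [|l /negPf neq_lj]; last first.
    by rewrite !mxE neq_lj.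
  by rewrite (inj_eq (addIr _)) !mulr1 (negPf neq_kj).
move=> l; have [->|neq_lj] := eqVneq l (lshift 1 j); [right|left] => i.
  by case: (split_ordP i) => i' ->; rewrite ?block_mxEul ?block_mxEdl // mxE eqxx.
case: (split_ordP l) neq_lj => l' ->; case: (split_ordP i) => i' ->;
  rewrite ?(block_mxEul, block_mxEdl, block_mxEur, block_mxEdr) //.
by rewrite mxE eq_lshift => /negPf ->.
Qed.

End FoolingFamily.

(** * The exponential size bound and its asymptotic form *)

(* A DNF is fooled by the yes-instances (A_0, A_X), a CNF by the no-instances
   (D, A_X) with D of rank m + 1; mixing exchanges the answer in both cases. *)
Lemma depth2_size_bound (m : nat)
    (C : depth2_circuit (2 ^ ((m.+1 + m.+1) + (1 + (m.+1 + 1))))) :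
  decides_group_iso C -> (2 ^ (m.+1 * m.+1) <= circuit_size C)%N.
Proof.
set d := (_ + (1 + _))%N in C * => decC.
have [undigits digitsK undigitsK] := digits_bij d.
pose T := @twisted_table 'F_2 (m.+1 + m.+1) (m.+1 + 1) _ (@digits d) undigits.
have bits_n : (up_log 2 (2 ^ d) <= d)%N by rewrite up_expnK.
have instE A B : eval_circuit C (encode (T A) (T B)) <-> \rank A = \rank B.
  by rewrite decC; apply: (twisted_table_instance pchar_F2).
have mixE := @encode_mixture _ _ _ _ (@digits d) _ undigitsK (@odd_digits d) bits_n.
have -> : (2 ^ (m.+1 * m.+1) = #|'M['F_2]_m.+1|)%N by rewrite card_mx card_Fp.
(* [leqW] gives up the output gate: the bottom gates alone reach the bound. *)
case: C {decC} instE => gs /= instE; apply: leqW.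
  pose D := dependent (0 : 'M['F_2]_m.+1).
  apply: (@fooling_set_bound _ _ gs
    (fun X => all (eval_literal (encode (T D) (T (dependent X)))))).
    by move=> X; apply/instE; rewrite !rank_dependent.
  move=> X1 X2 g gs_g g1 g2; apply/eqP/negPn/negP=> /dependent_mixture[B rB mixB].
  (* A term shared by [X1] and [X2] also accepts (D, B), whose ranks differ. *)
  have /instE : has (all (eval_literal (encode (T D) (T B)))) gs.
    apply/hasP; exists g; first exact: gs_g.
    exact: all_mixture (mixE D _ _ _ mixB) g1 g2.
  by rewrite rank_dependent rB addn1 => /n_Sn.
pose D : 'M['F_2]_(m.+1 + m.+1, m.+1 + 1) := pid_mx (m.+1 + 1).
(* There are enough rows for this rank since the block size is at least 1. *)
have rD : \rank D = (m.+1 + 1)%N by rewrite rank_pid_mx // leq_add2l.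
apply: (@fooling_set_bound _ _ gs
  (fun X => predC (has (eval_literal (encode (T D) (T (dependent X))))))).
  move=> X; rewrite has_predC; apply/negP=> /instE.
  by rewrite rD rank_dependent addn1 => /esym/n_Sn.
move=> X1 X2 g gs_g g1 g2; apply/eqP/negPn/negP=> /dependent_mixture[B rB mixB].
have /allP/(_ g gs_g) : all (has (eval_literal (encode (T D) (T B)))) gs.
  by apply/instE; rewrite rD rB.
move=> gB; have /orP[h|h] := has_mixture (mixE D _ _ _ mixB) gB.
  exact: (negP g1 h).
exact: (negP g2 h).
Qed.

Theorem theorem1 (R : realType) :
  exists c : R, 0 < c /\
    forall C : (forall n : nat, depth2_circuit n),
      (forall n : nat, (0 < n)%N -> decides_group_iso (C n)) ->
      forall N : nat, exists n : nat,
        (N < n)%N /\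
        n%:R `^ (c * ln n%:R) <= (circuit_size (C n))%:R.
Proof.
have ln2_gt0 : 0 < ln (2 : R) by rewrite ln_gt0 // ltr1n.
(* For [n = 2 ^ d] this makes [c * ln n] equal to d / 25, so the power is 2 ^ (d ^ 2 / 25). *)
exists (25 * ln 2)^-1; split; first by rewrite invr_gt0 mulr_gt0.
move=> C decC N.
pose d := ((N.+1 + N.+1) + (1 + (N.+1 + 1)))%N; exists (2 ^ d)%N; split.
  by apply: (@ltn_trans d); [rewrite /d; lia | apply: ltn_expl].
have /depth2_size_bound sizeC := decC _ (expn_gt0 2 d).
apply: le_trans (_ : (2 ^ (N.+1 * N.+1))%:R <= _); last by rewrite ler_nat.
(* With M = N + 1, d = 3 M + 2 is at most 5 M because M >= 1; hence the constant 25. *)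
have le_d : (d * d <= 25 * (N.+1 * N.+1))%N by rewrite /d; nia.
rewrite !natrX lnXn // -[ln 2 *+ d]mulr_natr -!powR_mulrn // -powRrM.
apply: ler_powR; first by rewrite ler1n.
rewrite invfM -mulrA [(ln 2)^-1 * _]mulrA mulVf ?gt_eqF // mul1r mulrCA.
by rewrite ler_pdivrMl // -!natrM ler_nat.
Qed.
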